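(* Let $\alpha\in(0,1/2)$ and $\beta\in(0,1-2\alpha)$. There exists a constant $c>0$ that only depends on $\alpha,\beta$ and $\sigma$ such that if $\varepsilon\le c\,\varepsilon^\star$, where $\varepsilon^\star=\varepsilon^\star(\tau)=\sqrt{(1\vee\log\tau)/n}$, then the asymptotic minimax type II error is at least $\beta$: $$\liminf_{n\to\infty}\ \inf_{\psi\in\Psi_\alpha}\ \sup_{P\in\mathcal{P}_{1,r}(\varepsilon;\tau)}P(\psi=0)\ \ge\ \beta .$$
   Context: Setting: $\boldsymbol X_1,\dots,\boldsymbol X_{2n}$ are i.i.d. random vectors from a distribution $P$ on $\mathbb{R}^d$, $d\ge2$, with mean $\boldsymbol\mu=(\mu_1,\dots,\mu_d)^\top$; the dimension $d=d_n$ may vary with $n$. Write $[d]=\{1,\dots,d\}$, $a\vee b=\max(a,b)$ (so $1\vee\log 0=1$), $\boldsymbol e_k$ for the $k$-th standard basis vector, and $\Theta=\Theta(P)=\arg\min_{k\in[d]}\mu_k$ for the set of all minimizing indices. Fix $r\in[d]$; the testing problem is $H_0:r\in\Theta$ versus $H_1:r\notin\Theta$. A test $\psi$ is a function of $\boldsymbol X_1,\dots,\boldsymbol X_{2n}$ with values in $\{0,1\}$, rejecting $H_0$ when $\psi=1$. Null class and tests: $\mathcal{P}_{0,r}$ is the collection of null distributions satisfying $r\in\Theta$ and the moment condition $$\max_{k\in[d]\setminus\{r\}}\ \sup_{P\in\mathcal{P}_{0,r}}\mathbb{E}_P\left[\frac{W_k^2}{\mathbb{E}_P[W_k^2]}\min\left\{1,\frac{|W_k|}{n^{1/2}(\mathbb{E}_P[W_k^2])^{1/2}}\right\}\right]=o(1)\quad(n\to\infty),\qquad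 W_k=(\boldsymbol e_r-\boldsymbol e_k)^\top(\boldsymbol X-\boldsymbol\mu).$$ The set of all asymptotic level-$\alpha$ tests over $\mathcal{P}_{0,r}$ is $$\Psi_\alpha=\Psi(\alpha,r)=\Bigl\{\psi:\ \limsup_{n\to\infty}\sup_{P\in\mathcal{P}_{0,r}}P(\psi=1)\le\alpha\Bigr\}.$$ Alternative class: let $\mu_\star=\min_{k\in[d]}\mu_k$ and $\Theta_{-r}=\arg\min_{k\in[d]\setminus\{r\}}\mu_k$ (the set of all minimizers). With $C_n$ any positive sequence such that $C_n\to\infty$, the confusion set is $$\mathbb{C}_r=\Bigl\{k\in[d]\setminus(\{r\}\cup\Theta_{-r}):\ \tfrac{\mu_r-\mu_\star}{2}\le\mu_k-\mu_\star\le C_n\sqrt{\tfrac{\log d}{n}}\Bigr\}.$$ $\mathcal{P}$ is the collection of distributions on $\mathbb{R}^d$ that are sub-Gaussian with fixed variance proxy $\sigma^2$: for every unit vector $\boldsymbol v\in\mathbb{R}^d$ and all $\lambda\in\mathbb{R}$, $\mathbb{E}_P[\exp(\lambda\langle\boldsymbol v,\boldsymbol X-\boldsymbol\mu\rangle)]\le\exp(\lambda^2\sigma^2/2)$. For $\varepsilon>0$ and $\tau\in\{0,1,\dots,d-2\}$, $$\mathcal{P}_{1,r}(\varepsilon;\tau)=\{P\in\mathcal{P}:\ \mu_r-\mu_\star\ge\varepsilon\ \text{and}\ |\mathbb{C}_r|=\tau\}.$$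
   Formalization: Proved as inf over ψ∈Ψ_α of liminf_n sup_P P(ψ=0) ≥ β (with liminf outside, the inf is 0 for each n, as Ψ_α is defined asymptotically); since no largest null class satisfies the o(1) condition, Ψ_α requires level α over every collection of null laws satisfying it. *)

(* Defs.v *)
From HB Require Import structures.
From mathcomp Require Import all_boot all_order all_algebra.
From mathcomp Require Import all_classical all_reals all_analysis.

Set Implicit Arguments.
Unset Strict Implicit.
Unset Printing Implicit Defensive.

Import Order.TTheory GRing.Theory Num.Theory.
Import numFieldNormedType.Exports.

Local Open Scope classical_set_scope.
Local Open Scope ring_scope.

Section iid_sample.
Context {disp : measure_display} {T : measurableType disp} {R : realType}.

Definition tuple_cons (m : nat) (x : T * m.-tuple T) : m.+1.-tuple T :=
  [the m.+1.-tuple T of x.1 :: x.2].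

Lemma measurable_tuple_cons (m : nat) :
  measurable_fun [set: T * m.-tuple T] (@tuple_cons m).
Proof. by apply: measurable_cons. Qed.

HB.instance Definition _ (m : nat) :=
  isMeasurableFun.Build _ _ _ _ (@tuple_cons m) (@measurable_tuple_cons m).

(* The m-fold product measure of P, i.e. the joint law of m i.i.d. draws from
   P, on the product sigma-algebra of m.-tuple T. *)
Fixpoint iid_law (P : probability T R) (m : nat) : probability (m.-tuple T) R :=
  match m with
  | 0 => \d_([tuple] : 0.-tuple T)
  | m'.+1 => distribution (P \x iid_law P m')%E (@tuple_cons m')
  end.

End iid_sample.

(* R^d with its Borel sigma-algebra, generated by the coordinates. *)
Notation rvec R d := (d.-tuple (measurableTypeR R)).

Section population.
Context {R : realType} {d : nat}.
Implicit Types (P : probability (rvec R d) R) (r k : 'I_d).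

Definition coordinate k (x : rvec R d) : R := tnth x k.

Definition has_mean P : Prop :=
  forall k, P.-integrable [set: rvec R d] (EFin \o coordinate k).

Definition mean P k : R := fine ('E_P[coordinate k])%E.

(* The set Theta(P). *)
Definition best P : pred 'I_d :=
  [pred k | [forall j, mean P k <= mean P j]].

(* The set Theta_{-r}(P). *)
Definition best_but P r : pred 'I_d :=
  [pred k | (k != r) && [forall (j | j != r), mean P k <= mean P j]].

(* The default value mean P r belongs to the family, so that this is mu_star. *)
Definition min_mean P r : R := \big[Num.min/mean P r]_(k < d) mean P k.

Definition confusion_set (C : R) (n : nat) P r : pred 'I_d :=
  [pred k | [&& k != r, ~~ best_but P r k,
    (mean P r - min_mean P r) / 2 <= mean P k - min_mean P r &
    mean P k - min_mean P r <= C * Num.sqrt (ln d%:R / n%:R)]].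

(* W_k = (e_r - e_k)^T (x - mu). *)
Definition contrast P r k (x : rvec R d) : R :=
  (coordinate r x - mean P r) - (coordinate k x - mean P k).

Definition contrast_var P r k : \bar R :=
  ('E_P[fun x => (contrast P r k x ^+ 2)%R])%E.

Definition truncated_moment (n : nat) P r k : \bar R :=
  let v := fine (contrast_var P r k) in
  ('E_P[fun x => (contrast P r k x ^+ 2 / v *
     Num.min 1 (`|contrast P r k x| / (Num.sqrt n%:R * Num.sqrt v)))%R])%E.

(* r is a best index; the variances of the contrasts are required to be positive
   and finite, as the normalized moments are undefined otherwise. *)
Definition null_distribution r P : Prop :=
  [/\ has_mean P,
      (forall k, k != r -> (0 < contrast_var P r k < +oo)%E) &
      best P r].

Definition sub_gaussian (sigma : R) P : Prop :=
  has_mean P /\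
  forall (v : 'I_d -> R) (lambda : R), \sum_(k < d) v k ^+ 2 = 1 ->
    ('E_P[fun x =>
         expR (lambda * \sum_(k < d) v k * (coordinate k x - mean P k))%R]
     <= (expR (lambda ^+ 2 * sigma ^+ 2 / 2))%:E)%E.

Definition alternative_class (sigma C : R) (n : nat) r (eps : R) (tau : nat) :
    set (probability (rvec R d) R) :=
  [set P | [/\ sub_gaussian sigma P,
      eps <= mean P r - min_mean P r &
      #|confusion_set C n P r| = tau]].

End population.

Section tests.
Context {R : realType}.
Variables (d : nat -> nat) (r : forall n, 'I_(d n)).

(* The n-th test is based on a sample of size 2n; true means rejection. *)
Definition test_sequence :=
  forall n, {mfun (2 * n).-tuple (rvec R (d n)) >-> bool}.

(* The o(1) condition is a property of a sequence of classes, one for each n.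
   The base value 0 of the maximum only matters when the n-th class is empty,
   since the moments are nonnegative. *)
Definition null_collection
    (P0 : forall n, set (probability (rvec R (d n)) R)) : Prop :=
  (forall n, P0 n `<=` null_distribution (r n)) /\
  (\big[maxe/0%E]_(k < d n | k != r n)
     ereal_sup [set truncated_moment n P (r n) k | P in P0 n])
    @[n --> \oo] --> 0%E.

Definition type1_error (psi : test_sequence) (n : nat)
    (P : probability (rvec R (d n)) R) : \bar R :=
  iid_law P (2 * n) [set x | psi n x = true].

Definition type2_error (psi : test_sequence) (n : nat)
    (P : probability (rvec R (d n)) R) : \bar R :=
  iid_law P (2 * n) [set x | psi n x = false].

(* There is no largest collection satisfying the o(1) condition, hence the
   quantification over all of them. *)
Definition asymptotic_level (alpha : R) : set test_sequence :=
  [set psi | forall P0, null_collection P0 ->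
    (limn_esup (fun n => ereal_sup [set type1_error psi P | P in P0 n])
       <= alpha%:E)%E].

End tests.

Definition critical_radius {R : realType} (n tau : nat) : R :=
  Num.sqrt (Num.max 1 (ln tau%:R) / n%:R).

(* Main.v *)
(* The base law is Gaussian with covariance [sigma ^+ 2] times the identity; the
   coordinate [r] and those of a set [S] of [tau + 1] indices are centered, and
   all others have a mean above the confusion window. It satisfies the null
   hypothesis. Lowering by [eps] the mean of a single [j] in [S] gives [tau + 1]
   alternatives, for which [j] is the only minimizer and the rest of [S] is the
   confusion set. Over [2 n] draws, the likelihood ratios of distinct
   alternatives are uncorrelated, and each of them has the second moment
   [expR (eps ^+ 2 / sigma ^+ 2) ^+ (2 * n)]. Hence the chi-square divergence
   between the base law and the average alternative is this second moment minus
   1, divided by [tau + 1], which is at most [delta ^+ 2] below the critical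
   radius: some alternative is rejected with probability at most [delta] more
   than the base law.
   All Gaussian computations rest on exponential tilting: the density of
   [normal_prob (m + s ^+ 2 * c) s] with respect to [normal_prob m s] is
   [expR (c * (x - m) - s ^+ 2 * c ^+ 2 / 2)]. As it has integral 1, it gives
   the moment generating function, which in turn is all that is needed to obtain
   the means and the bounds on the second and third moments of the contrasts. *)
Require Import Defs.
From mathcomp Require Import all_boot all_order all_algebra.
From mathcomp Require Import all_classical all_reals all_analysis.
From mathcomp Require Import measurable_realfun.
From mathcomp Require Import ring lra.

Set Implicit Arguments.
Unset Strict Implicit.
Unset Printing Implicit Defensive.

Import Order.TTheory GRing.Theory Num.Theory.
Import numFieldNormedType.Exports.

Local Open Scope classical_set_scope.
Local Open Scope ring_scope.

(** * Elementary inequalities and limits *)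

Lemma sumr_delta (R : pzSemiRingType) (I : finType) (j : I) (f : I -> R) :
  \sum_i (i == j)%:R * f i = f j.
Proof.
rewrite (bigD1 j)//= eqxx mul1r big1 ?addr0// => i /negbTE ->.
by rewrite mul0r.
Qed.

Section expR_bounds.
Context {R : realType}.
Implicit Types x : R.

Lemma normrX_le_expR x n :
  `|x| ^+ n.+1 <= n.+1`!%:R * (expR x + expR (- x)).
Proof.
rewrite mulrC -ler_pdivrMr//; have := expR_ge1Dxn n (normr_ge0 x).
have : expR `|x| <= expR x + expR (- x).
  by case: (ger0P x) => _; rewrite ?lerDl ?lerDr expR_ge0.
lra.
Qed.

Lemma expR_half_bounds : 3 / 2 <= expR (1 / 2 : R) <= 2.
Proof.
have half_ge := expR_ge1Dx (1 / 2 : R).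
have opp_half_ge := expR_ge1Dx (- (1 / 2) : R).
have := expRxMexpNx_1 (1 / 2 : R).
by move: (expR _) (expR _) half_ge opp_half_ge => a b; nra.
Qed.

Lemma expR1_le4 : expR 1 <= 4 :> R.
Proof.
have /andP[half_ge half_le] := expR_half_bounds.
rewrite [in leLHS](_ : 1 = 1 / 2 + 1 / 2); last by field.
by rewrite expRD; nra.
Qed.

Lemma affine_le_expR_sqr_eq0 (v a : R) : 0 < v ->
  (forall y, 1 + y * a <= expR (v * y ^+ 2 / 2)) -> a = 0.
Proof.
move=> v_gt0 aff; apply/eqP; apply: contraT => a_neq0.
(* The inequality fails at [y = t * a / v]. *)
pose w := a ^+ 2 / v; have w_gt0 : 0 < w.
  by rewrite divr_gt0// exprn_even_gt0.
pose t := (1 + w)^-1; have t_gt0 : 0 < t by rewrite invr_gt0; lra.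
have tw : t * w = 1 - t.
  by have : t * (1 + w) = 1 by [rewrite mulVf// gt_eqF//; lra]; lra.
have t_lt1 : t < 1 by have := mulr_gt0 t_gt0 w_gt0; lra.
have := aff (t * a / v).
have -> : t * a / v * a = 1 - t by rewrite -tw /w; field; rewrite gt_eqF.
have -> : v * (t * a / v) ^+ 2 / 2 = t * (1 - t) / 2.
  by rewrite -tw /w; field; rewrite gt_eqF.
set u := _ / 2 => expR_ge.
have u_lt1 : 0 < 1 - u by rewrite /u; nra.
have : (2 - t) * (1 - u) <= expR u * expR (- u).
  by apply: ler_pM; have := expR_ge1Dx (- u); lra.
have : 0 < (1 - t) * (1 - t + t ^+ 2 / 2) by rewrite mulr_gt0//; nra.
by rewrite expRxMexpNx_1 /u; lra.
Qed.

(* [expR x <= 1 + x * expR x], and AM-GM splits the product. *)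
Lemma expR_le_sqr (t x : R) : 0 < t ->
  expR x <= 1 + (t / 2 * x ^+ 2 + (2 * t)^-1 * expR (2 * x)).
Proof.
move=> t_gt0; have e_gt0 := expR_gt0 x.
have expR_le : expR x <= 1 + x * expR x.
  have := ler_wpM2l (ltW e_gt0) (expR_ge1Dx (- x)); rewrite expRxMexpNx_1; lra.
apply: le_trans expR_le _; rewrite lerD2l expRM_natl -subr_ge0.
have -> : t / 2 * x ^+ 2 + (2 * t)^-1 * expR x ^+ 2 - x * expR x =
    (t * x - expR x) ^+ 2 / (2 * t) by field; rewrite gt_eqF.
by rewrite divr_ge0 ?sqr_ge0// mulr_ge0// ltW.
Qed.

Lemma expR_scale_sub1_le (b L : R) : 0 <= b <= 1 ->
  expR (b * L) - 1 <= b * (expR L - 1).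
Proof.
move=> /andP[b_ge0 b_le1].
have := convex_expR (Itv01 b_ge0 b_le1) L 0.
rewrite !convRE/= expR0 /unstable.onem mulr0 addr0; lra.
Qed.

End expR_bounds.

Lemma le_limn_einf (R : realType) (u v : nat -> \bar R) :
  (\forall n \near \oo, (u n <= v n)%E) -> (limn_einf u <= limn_einf v)%E.
Proof.
move=> [N _ uv]; rewrite !limn_einf_lim; apply: lee_lim.
- exact: is_cvg_einfs.
- exact: is_cvg_einfs.
exists N => // n Nn; apply: le_ereal_inf_tmp => _ [m /= nm <-].
apply: (@le_trans _ _ (u m)); last exact: uv (leq_trans Nn nm).
by apply: ereal_inf_lbound; exists m.
Qed.

Lemma cvg_div_sqrtn (R : realType) (b : R) :
  (b / Num.sqrt n%:R)%:E @[n --> \oo] --> 0%E.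
Proof.
apply: cvg_EFin; first exact: nearW.
have natrV_cvg0 : n%:R^-1 @[n --> \oo] --> (0 : R).
  by apply/gtr0_cvgV0; [near=> n; rewrite ltr0n; near: n; exact: nbhs_infty_gt
    |exact: cvgr_idn].
rewrite -[X in _ --> X](mulr0 b) -sqrtr0; apply: cvgMl_tmp.
under eq_fun do rewrite -sqrtrV//.
exact: continuous_cvg _ (@sqrt_continuous R 0) natrV_cvg0.
Unshelve. all: by end_near. Qed.

(** * Likelihood ratios and product laws *)

Section density.
Context {disp : measure_display} {T : measurableType disp} {R : realType}.
Context (mu nu : {measure set T -> \bar R}) (g : T -> R).
Hypotheses (mg : measurable_fun [set: T] g) (g_ge0 : forall x, 0 <= g x).
Local Open Scope ereal_scope.
Hypothesis nuE : forall A, measurable A -> nu A = \int[mu]_(x in A) (g x)%:E.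

Import HBNNSimple.

Let mEg : measurable_fun [set: T] (EFin \o g).
Proof. exact/measurable_EFinP. Qed.

Let nnsfun_integral_density (h : {nnsfun T >-> R}) :
  \int[nu]_x (h x)%:E = \int[mu]_x ((h x)%:E * (g x)%:E).
Proof.
pose c r x : \bar R := (r * \1_(h @^-1` [set r]) x)%:E.
have c_ge0 r x : 0 <= c r x by exact: nnfun_muleindic_ge0.
have mc r : measurable_fun [set: T] (c r).
  by apply/measurable_EFinP; exact: measurable_funM.
have hE x : (h x)%:E = \sum_(r \in range h) c r x.
  by rewrite [in LHS]fimfunE -fsumEFin.
under eq_integral do rewrite hE.
under [RHS]eq_integral do rewrite hE ge0_mule_fsuml//.
rewrite !ge0_integral_fsum//; last 2 first.
- by move=> r; exact: emeasurable_funM.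
- by move=> r x _; rewrite mule_ge0 ?c_ge0 ?lee_fin.
apply: eq_fsbigr => r /set_mem[y _ <-].
under eq_integral do rewrite [c _ _]EFinM.
under [RHS]eq_integral do rewrite [c _ _]EFinM -muleA.
rewrite !ge0_integralZl ?lee_fin//.
- rewrite integral_indic// setIT nuE// integral_mkcond; congr (_ * _).
  by apply: eq_integral => x _; rewrite epatch_indic muleC.
- by apply: emeasurable_funM => //; exact/measurable_EFinP.
- by move=> x _; rewrite mule_ge0 ?lee_fin.
- exact/measurable_EFinP.
Qed.

Lemma ge0_integral_density (f : T -> \bar R) :
  measurable_fun [set: T] f -> (forall x, 0 <= f x) ->
  \int[nu]_x f x = \int[mu]_x (f x * (g x)%:E).
Proof.
move=> mf f_ge0; pose h := nnsfun_approx measurableT mf.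
have h_cvg x : (h n x)%:E @[n --> \oo] --> f x by exact: cvg_nnsfun_approx.
have h_le x : {homo h^~ x : m n / (m <= n)%N >-> (m <= n)%R}.
  by move=> m n mn; exact/lefP/nd_nnsfun_approx.
have mh n : measurable_fun [set: T] (EFin \o h n) by exact/measurable_EFinP.
have -> : \int[nu]_x f x = limn (fun n => \int[nu]_x (h n x)%:E).
  rewrite -monotone_convergence//.
  - by apply: eq_integral => x _; exact/esym/(cvg_lim _ (h_cvg x)).
  - by move=> n x _; rewrite lee_fin.
  - by move=> x _ m n mn; rewrite lee_fin h_le.
under eq_fun do rewrite nnsfun_integral_density.
rewrite -monotone_convergence//.
- by apply: eq_integral => x _; apply/cvg_lim => //; exact: cvgeZr.
- by move=> n; exact: emeasurable_funM (mh n) mEg.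
- by move=> n x _; rewrite mule_ge0 ?lee_fin.
- by move=> x _ m n mn; rewrite lee_wpmul2r ?lee_fin ?h_le.
Qed.

End density.

Section ge0_integral_EFin.
Context {disp : measure_display} {T : measurableType disp} {R : realType}.
Context (mu : {measure set T -> \bar R}).

Lemma ge0_integral_scale (a : R) (f : T -> R) : 0 <= a ->
  measurable_fun [set: T] f -> (forall x, 0 <= f x) ->
  (\int[mu]_x (a * f x)%:E = a%:E * \int[mu]_x (f x)%:E)%E.
Proof.
move=> a_ge0 mf f_ge0; under eq_integral do rewrite EFinM.
rewrite ge0_integralZl//; first exact/measurable_EFinP.
by move=> x _; rewrite lee_fin.
Qed.

Lemma ge0_integral_linear (a : R) (f g : T -> R) : 0 <= a ->
  measurable_fun [set: T] f -> measurable_fun [set: T] g ->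
  (forall x, 0 <= f x) -> (forall x, 0 <= g x) ->
  (\int[mu]_x (f x + a * g x)%:E =
   \int[mu]_x (f x)%:E + a%:E * \int[mu]_x (g x)%:E)%E.
Proof.
move=> a_ge0 mf mg f_ge0 g_ge0; under eq_integral do rewrite EFinD.
rewrite ge0_integralD// ?ge0_integral_scale//.
- by move=> x _; rewrite lee_fin.
- exact/measurable_EFinP.
- by move=> x _; rewrite lee_fin mulr_ge0.
- by apply/measurable_EFinP; exact: measurable_funM.
Qed.

Lemma ge0_integral_scaled_sum (I : finType) (c : R) (f : I -> T -> R)
    (a : I -> R) :
  0 <= c -> (forall i, measurable_fun [set: T] (f i)) ->
  (forall i x, 0 <= f i x) -> (forall i, \int[mu]_x (f i x)%:E = (a i)%:E)%E ->
  (\int[mu]_x (c * \sum_i f i x)%:E = (c * \sum_i a i)%:E)%E.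
Proof.
move=> c_ge0 mf f_ge0 fE; rewrite ge0_integral_scale//; last 2 first.
- exact: measurable_sum.
- by move=> x; exact: sumr_ge0.
rewrite EFinM -sumEFin; congr (_ * _)%E; under eq_integral do rewrite -sumEFin.
rewrite ge0_integral_sum//; first by apply: eq_bigr => i _.
- by move=> i; exact/measurable_EFinP.
- by move=> i x _; rewrite lee_fin.
Qed.

End ge0_integral_EFin.

Lemma integral_probability_cst (disp : measure_display)
    (T : measurableType disp) (R : realType) (P : probability T R) (a : R) :
  (\int[P]_x a%:E = a%:E)%E.
Proof. by have := expectation_cst P a; rewrite unlock. Qed.

Section likelihood_ratio.
Context {disp : measure_display} {T : measurableType disp} {R : realType}.
Implicit Types (P Q : probability T R) (l : T -> R).

Definition likelihood_ratio P Q l : Prop :=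
  [/\ measurable_fun [set: T] l, (forall x, 0 <= l x) &
      forall f : T -> \bar R, measurable_fun [set: T] f ->
        (forall x, 0 <= f x)%E ->
        (\int[Q]_x f x = \int[P]_x (f x * (l x)%:E))%E].

Lemma likelihood_ratio_measure P Q l A : likelihood_ratio P Q l ->
  measurable A -> (Q A = \int[P]_x (\1_A x * l x)%:E)%E.
Proof.
case=> _ _ QE mA; rewrite -(setIT A) -integral_indic// QE//.
- by rewrite setIT; apply: eq_integral => x _; rewrite -EFinM.
- exact/measurable_EFinP/measurable_indic.
Qed.

Lemma likelihood_ratio_total P Q l : likelihood_ratio P Q l ->
  (\int[P]_x (l x)%:E = 1)%E.
Proof.
move=> PQl; rewrite -(@probability_setT _ _ _ Q).
rewrite (likelihood_ratio_measure PQl)//.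
by apply: eq_integral => x _; rewrite indicT mul1r.
Qed.

End likelihood_ratio.

Lemma likelihood_ratio_distribution (disp disp' : measure_display)
    (T : measurableType disp) (T' : measurableType disp') (R : realType)
    (P Q : probability T R) (X : {mfun T >-> T'}) (l : T' -> R) :
  measurable_fun [set: T'] l -> (forall y, 0 <= l y) ->
  likelihood_ratio P Q (l \o X) ->
  likelihood_ratio (distribution P X) (distribution Q X) l.
Proof.
move=> ml l_ge0 [_ _ QE]; split=> // f mf f_ge0.
rewrite !ge0_integral_distribution//.
- by rewrite QE// => [|x]; [apply: measurableT_comp|exact: f_ge0].
- by apply: emeasurable_funM => //; exact/measurable_EFinP.
- by move=> y; rewrite mule_ge0 ?lee_fin.
Qed.

Lemma likelihood_ratio_prod (disp1 disp2 : measure_display)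
    (T1 : measurableType disp1) (T2 : measurableType disp2) (R : realType)
    (P1 Q1 : probability T1 R) (P2 Q2 : probability T2 R)
    (l1 : T1 -> R) (l2 : T2 -> R) :
  likelihood_ratio P1 Q1 l1 -> likelihood_ratio P2 Q2 l2 ->
  likelihood_ratio (P1 \x P2)%E (Q1 \x Q2)%E (fun y => l1 y.1 * l2 y.2).
Proof.
move=> [ml1 l1_ge0 Q1E] [ml2 l2_ge0 Q2E].
have ml1_fst : measurable_fun [set: T1 * T2] (fun y => l1 y.1).
  exact: measurableT_comp.
have ml2_snd : measurable_fun [set: T1 * T2] (fun y => l2 y.2).
  exact: measurableT_comp.
split=> [|y|f mf f_ge0]; [exact: measurable_funM|by rewrite mulr_ge0|].
have mfl2 : measurable_fun [set: T1 * T2] (fun y => f y * (l2 y.2)%:E)%E.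
  by apply: emeasurable_funM => //; exact/measurable_EFinP.
have fl2_ge0 y : (0 <= f y * (l2 y.2)%:E)%E by rewrite mule_ge0 ?lee_fin.
rewrite [LHS]fubini_tonelli1// [RHS]fubini_tonelli1//; last 2 first.
- apply: emeasurable_funM => //; apply/measurable_EFinP.
  exact: measurable_funM.
- by move=> y; rewrite mule_ge0// lee_fin mulr_ge0.
under eq_integral => x _.
  rewrite /fubini_F Q2E//; last exact: measurable_fun_pair2.
  over.
rewrite Q1E.
- apply: eq_integral => x _; rewrite -ge0_integralZr ?lee_fin//.
  + by apply: eq_integral => z _; rewrite -muleA -EFinM [l2 z * _]mulrC.
  + exact: (measurable_fun_pair2 x mfl2).
- exact: (measurable_fun_fubini_tonelli_F _ mfl2).
- by move=> x; apply: integral_ge0 => z _; exact: (fl2_ge0 (x, z)).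
Qed.

Section product_law.
Context {disp : measure_display} {T : measurableType disp} {R : realType}.

Fixpoint product_law (m : nat) :
    ('I_m -> probability T R) -> probability (m.-tuple T) R :=
  match m with
  | 0 => fun=> \d_([tuple] : 0.-tuple T)
  | m'.+1 => fun P =>
      distribution (P ord0 \x product_law (fun k => P (lift ord0 k)))%E
        (@tuple_cons _ _ m')
  end.

Lemma iid_lawE (P : probability T R) m :
  iid_law P m = product_law (fun _ : 'I_m => P).
Proof. by elim: m => //= m ->. Qed.

Lemma prod_tnth_tuple_cons m (h : 'I_m.+1 -> T -> R) (y : T * m.-tuple T) :
  \prod_k h k (tnth (tuple_cons y) k) =
  h ord0 y.1 * \prod_k h (lift ord0 k) (tnth y.2 k).
Proof.
rewrite big_ord_recl; congr (_ * _); apply: eq_bigr => k _.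
by congr h; rewrite /tuple_cons tnthS.
Qed.

Lemma measurable_fun_tuple_cons m (f : m.+1.-tuple T -> \bar R) :
  measurable_fun [set: m.+1.-tuple T] f ->
  measurable_fun [set: T * m.-tuple T] (f \o @tuple_cons _ T m).
Proof.
by move=> mf; apply: measurableT_comp => //; exact: measurable_tuple_cons.
Qed.

Lemma ge0_integral_product_lawS m (P : 'I_m.+1 -> probability T R)
    (f : m.+1.-tuple T -> \bar R) :
  measurable_fun [set: m.+1.-tuple T] f -> (forall x, 0 <= f x)%E ->
  (\int[product_law P]_x f x = \int[P ord0]_x
     \int[product_law (fun k => P (lift ord0 k))]_z f (tuple_cons (x, z)))%E.
Proof.
move=> mf f0; rewrite /= ge0_integral_distribution// fubini_tonelli1//.
- exact: measurable_fun_tuple_cons.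
- by move=> x; exact: f0.
Qed.

Lemma measurable_prod_tnth m (h : 'I_m -> T -> R) :
  (forall k, measurable_fun [set: T] (h k)) ->
  measurable_fun [set: m.-tuple T] (fun x => \prod_k h k (tnth x k)).
Proof.
move=> mh; apply: measurable_prod => k _.
by apply: measurableT_comp => //; exact: measurable_tnth.
Qed.

Lemma ge0_integral_product_law_prod m (P : 'I_m -> probability T R)
    (h : 'I_m -> T -> R) (c : 'I_m -> R) :
  (forall k, measurable_fun [set: T] (h k)) -> (forall k x, 0 <= h k x) ->
  (forall k, \int[P k]_x (h k x)%:E = (c k)%:E)%E ->
  (\int[product_law P]_x (\prod_k h k (tnth x k))%:E = (\prod_k c k)%:E)%E.
Proof.
elim: m P h c => [|m IH] P h c mh h0 hc.
  rewrite integral_dirac//= ?big_ord0 ?diracT ?mul1e//.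
  by apply/measurable_EFinP; exact: measurable_prod_tnth.
rewrite ge0_integral_product_lawS; last 2 first.
- by apply/measurable_EFinP; exact: measurable_prod_tnth.
- by move=> x; rewrite lee_fin prodr_ge0.
rewrite big_ord_recl EFinM -hc -ge0_integralZr//; last 3 first.
- exact/measurable_EFinP.
- by move=> x _; rewrite lee_fin.
- rewrite lee_fin prodr_ge0// => k _; rewrite -lee_fin -hc.
  by apply: integral_ge0 => x _; rewrite lee_fin.
apply: eq_integral => x _.
rewrite -(IH (fun k => P (lift ord0 k)) (fun k => h (lift ord0 k)))//.
rewrite -ge0_integralZl ?lee_fin//.
- by apply: eq_integral => z _; rewrite prod_tnth_tuple_cons.
- apply/measurable_EFinP.
  exact: (@measurable_prod_tnth _ (fun k => h (lift ord0 k))).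
- by move=> z _; rewrite lee_fin prodr_ge0.
Qed.

Lemma likelihood_ratio_product_law m (P Q : 'I_m -> probability T R)
    (l : 'I_m -> T -> R) :
  (forall k, likelihood_ratio (P k) (Q k) (l k)) ->
  likelihood_ratio (product_law P) (product_law Q)
    (fun x => \prod_k l k (tnth x k)).
Proof.
elim: m P Q l => [|m IH] P Q l PQl.
  split=> [|x|f mf f_ge0]; first by apply: measurable_prod_tnth => -[].
  - by rewrite big_ord0.
  - by apply: eq_integral => x _; rewrite big_ord0 mule1.
have ml k : measurable_fun [set: T] (l k) by have [] := PQl k.
have l_ge0 k x : 0 <= l k x by have [_ + _] := PQl k; exact.
apply: likelihood_ratio_distribution; first exact: measurable_prod_tnth.
  by move=> x; rewrite prodr_ge0.
rewrite [X in likelihood_ratio _ _ X](_ : _ = fun y : T * m.-tuple T =>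
  l ord0 y.1 * \prod_k l (lift ord0 k) (tnth y.2 k)).
  exact: (likelihood_ratio_prod (PQl ord0)
    (IH _ _ _ (fun k => PQl (lift ord0 k)))).
by apply/funext => y /=; rewrite prod_tnth_tuple_cons.
Qed.

End product_law.

(** * The second moment method *)

Section second_moment_method.
Context {disp : measure_display} {T : measurableType disp} {R : realType}.
Context (P : probability T R) (A : set T) (delta : R).
Hypotheses (mA : measurable A) (delta_gt0 : 0 < delta).

(* Completing the square replaces the Cauchy-Schwarz inequality. *)
Let indic_density_le (e : bool) (u : R) :
  e%:R * u + delta^-1 * u <=
  e%:R + (2 * delta)^-1 * (u ^+ 2 + (1 + delta ^+ 2) * 1).
Proof.
have -> : e%:R + (2 * delta)^-1 * (u ^+ 2 + (1 + delta ^+ 2) * 1) =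
    e%:R * u + delta^-1 * u + (2 * delta)^-1 *
      ((u - 1 - e%:R * delta) ^+ 2 + (1 - e%:R ^+ 2) * delta ^+ 2).
  by move: (e%:R : R) => x; field; rewrite gt_eqF.
rewrite lerDl mulr_ge0 ?invr_ge0 ?mulr_ge0 ?(ltW delta_gt0)//.
rewrite addr_ge0 ?sqr_ge0// mulr_ge0 ?sqr_ge0// subr_ge0.
by case: e; rewrite ?expr1n ?expr0n.
Qed.

Lemma integral_density_le (l : T -> R) :
  measurable_fun [set: T] l -> (forall x, 0 <= l x) ->
  (\int[P]_x (l x)%:E = 1)%E ->
  (\int[P]_x (l x ^+ 2)%:E <= (1 + delta ^+ 2)%:E)%E ->
  (\int[P]_x (\1_A x * l x)%:E <= P A + delta%:E)%E.
Proof.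
move=> ml l_ge0 l_mean l_sqr.
have idelta_ge0 : 0 <= delta^-1 by rewrite invr_ge0 ltW.
pose b := (2 * delta)^-1; pose k := 1 + delta ^+ 2.
have b_ge0 : 0 <= b by rewrite invr_ge0 mulr_ge0// ltW.
have k_ge0 : 0 <= k by rewrite addr_ge0// sqr_ge0.
have mAl : measurable_fun [set: T] (fun x => \1_A x * l x).
  exact: measurable_funM.
have ml2 : measurable_fun [set: T] (fun x => l x ^+ 2).
  exact: measurable_funX.
have ml2k : measurable_fun [set: T] (fun x => l x ^+ 2 + k * 1).
  exact: measurable_funD.
have l2_ge0 x : 0 <= l x ^+ 2 by exact: sqr_ge0.
have l2k_ge0 x : 0 <= l x ^+ 2 + k * 1 by rewrite addr_ge0// mulr_ge0.
have Al_ge0 x : 0 <= \1_A x * l x by rewrite mulr_ge0.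
have : (\int[P]_x (\1_A x * l x + delta^-1 * l x)%:E <=
    \int[P]_x (\1_A x + b * (l x ^+ 2 + k * 1))%:E)%E.
  apply: ge0_le_integral => //.
  - by move=> x _; rewrite lee_fin addr_ge0// mulr_ge0.
  - apply/measurable_EFinP; apply: measurable_funD => //.
    exact: measurable_funM.
  - apply/measurable_EFinP; apply: measurable_funD => //.
    exact: measurable_funM.
  - by move=> x _; rewrite lee_fin indicE indic_density_le.
rewrite !ge0_integral_linear//.
rewrite l_mean mule1 integral_indic// setIT integral_probability_cst mule1.
move=> /le_trans/(_ (leeD2l _ (lee_wpmul2l _ (leeD2r _ l_sqr)))).
rewrite -EFinD -EFinM (_ : b * (1 + delta ^+ 2 + k) = delta + delta^-1).
  by rewrite EFinD addeA leeD2rE//; apply; rewrite lee_fin.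
by rewrite /b /k; field; rewrite gt_eqF.
Qed.

Context (I : finType) (Q : I -> probability T R).
Context (l : I -> T -> R) (B : R).
Hypothesis lrQ : forall j, likelihood_ratio P (Q j) (l j).
Hypothesis overlap : forall j k,
  (\int[P]_x (l j x * l k x)%:E = (if j == k then B else 1)%:E)%E.
Hypotheses (I_gt0 : (0 < #|I|)%N) (B_le : B - 1 <= delta ^+ 2 * #|I|%:R).

Let N : R := #|I|%:R.
Let mixture x : R := N^-1 * \sum_j l j x.

Let N_gt0 : 0 < N. Proof. by rewrite ltr0n. Qed.

Let ml j : measurable_fun [set: T] (l j). Proof. by have [] := lrQ j. Qed.

Let l_ge0 j x : 0 <= l j x. Proof. by have [_ + _] := lrQ j; exact. Qed.

Let integral_mixture : (\int[P]_x (mixture x)%:E = 1)%E.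
Proof.
rewrite (ge0_integral_scaled_sum (a := fun=> 1))// ?invr_ge0 ?ltW//.
  by rewrite sumr_const cardT -cardE mulVf ?gt_eqF.
by move=> j; exact: likelihood_ratio_total.
Qed.

Let integral_mixture_sqr :
  (\int[P]_x (mixture x ^+ 2)%:E <= (1 + delta ^+ 2)%:E)%E.
Proof.
pose a (p : I * I) : R := 1 + (p.2 == p.1)%:R * (B - 1).
have -> : (\int[P]_x (mixture x ^+ 2)%:E =
    \int[P]_x (N ^- 2 * \sum_p l p.1 x * l p.2 x)%:E)%E.
  apply: eq_integral => x _; rewrite exprMn exprVn [(\sum_j _) ^+ 2]expr2.
  by rewrite big_distrlr pair_bigA.
rewrite (ge0_integral_scaled_sum (a := a)).
- rewrite lee_fin -(pair_bigA _ (fun j k => a (j, k))) /a/=.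
  under eq_bigr do rewrite big_split sumr_const sumr_delta/=.
  rewrite sumr_const -/N -mulr_natr (_ : #|_|%:R = N)//.
  rewrite (_ : N ^- 2 * _ = 1 + (B - 1) / N); last by field; rewrite gt_eqF.
  by rewrite lerD2l ler_pdivrMr.
- by rewrite invr_ge0 sqr_ge0.
- by move=> p; exact: measurable_funM.
- by move=> p x; rewrite mulr_ge0.
- move=> p; rewrite overlap /a eq_sym.
  by case: eqP => _; congr (_%:E); rewrite /=; ring.
Qed.

Lemma exists_alternative_le : exists j, (Q j A <= P A + delta%:E)%E.
Proof.
apply/not_existsP => Q_gt.
have mmix : measurable_fun [set: T] mixture.
  by apply: measurable_funM => //; exact: measurable_sum.
have mixture_ge0 x : 0 <= mixture x.
  by rewrite mulr_ge0 ?sumr_ge0 ?invr_ge0 ?ltW.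
have := integral_density_le mmix mixture_ge0 integral_mixture
  integral_mixture_sqr.
apply/negP; rewrite -ltNge.
under eq_integral do rewrite mulrCA mulr_sumr.
have QA_fin j : Q j A \is a fin_num by exact: fin_num_measure.
have PA_fin : P A \is a fin_num by exact: fin_num_measure.
rewrite (ge0_integral_scaled_sum (a := fun j => fine (Q j A))).
- rewrite -(fineK PA_fin) -EFinD lte_fin ltr_pdivlMl// /N mulr_natl -sumr_const.
  apply: ltr_sum => [|j _].
    have /card_gt0P[j _] := I_gt0.
    by apply/hasP; exists j => //; exact: mem_index_enum.
  rewrite -lte_fin EFinD !fineK// ltNge; exact/negP/Q_gt.
- by rewrite invr_ge0 ltW.
- by move=> j; apply: measurable_funM => //; exact: measurable_indic.
- by move=> j x; rewrite mulr_ge0.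
- by move=> j; rewrite fineK// (likelihood_ratio_measure (lrQ j)).
Qed.

End second_moment_method.

Lemma exists_iid_alternative_le (disp : measure_display)
    (T : measurableType disp) (R : realType) (P : probability T R)
    (I : finType) (Q : I -> probability T R) (l : I -> T -> R)
    (B delta : R) (m : nat) (A : set (m.-tuple T)) :
  measurable A -> 0 < delta -> (0 < #|I|)%N ->
  (forall j, likelihood_ratio P (Q j) (l j)) ->
  (forall j k,
    (\int[P]_x (l j x * l k x)%:E = (if j == k then B else 1)%:E)%E) ->
  B ^+ m - 1 <= delta ^+ 2 * #|I|%:R ->
  exists j, (iid_law (Q j) m A <= iid_law P m A + delta%:E)%E.
Proof.
move=> mA delta_gt0 I_gt0 lrQ overlap B_le.
under eq_exists do rewrite !iid_lawE.
apply: (@exists_alternative_le _ _ _ _ _ _ mA delta_gt0 _ _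
  (fun j x => \prod_i l j (tnth x i)) (B ^+ m)) => // [j|j k].
  exact: (likelihood_ratio_product_law (fun=> lrQ j)).
have [mlj lj_ge0 _] := lrQ j; have [mlk lk_ge0 _] := lrQ k.
under eq_integral do rewrite -big_split.
rewrite (@ge0_integral_product_law_prod _ _ _ _ _ (fun _ x => l j x * l k x)
  (fun=> if j == k then B else 1))//.
- by rewrite prodr_const card_ord; case: ifP => //; rewrite expr1n.
- by move=> _; apply: measurable_funM; [exact: mlj|exact: mlk].
- by move=> _ x; rewrite mulr_ge0.
Qed.

(** * Gaussian laws *)

Definition truncation_bound {R : realType} (n : nat) : R :=
  12 * expR (1 / 2) * (2 * expR 1) ^+ 3 / Num.sqrt n%:R.

Section gaussian_mgf.
Context {disp : measure_display} {T : measurableType disp} {R : realType}.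

Definition gaussian_mgf (P : probability T R) (s : R) (W : T -> R) : Prop :=
  measurable_fun [set: T] W /\
  forall y, ('M_P W y = (expR (s ^+ 2 * y ^+ 2 / 2))%:E)%E.

Context (P : probability T R) (s : R) (W : T -> R).
Hypotheses (s_gt0 : 0 < s) (mgfW : gaussian_mgf P s W).

Let mW : measurable_fun [set: T] W. Proof. by have [] := mgfW. Qed.

Let integral_expR y :
  (\int[P]_x (expR (y * W x))%:E = (expR (s ^+ 2 * y ^+ 2 / 2))%:E)%E.
Proof.
have [_ <-] := mgfW; rewrite /mmt_gen_fun unlock.
by apply: eq_integral => x _ /=; rewrite mulrC.
Qed.

Let measurable_expR_scaled y :
  measurable_fun [set: T] (fun x => expR (y * W x)).
Proof. by apply: measurableT_comp => //; exact: measurable_funM. Qed.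

Let measurable_normX n : measurable_fun [set: T] (fun x => (`|W x| ^+ n)%:E).
Proof.
by apply/measurable_EFinP/measurable_funX; exact: measurableT_comp.
Qed.

Lemma gaussian_mgf_abs_moment_le n : (\int[P]_x (`|W x| ^+ n.+1)%:E <=
  (n.+1`!%:R * (2 * expR (1 / 2)) * s ^+ n.+1)%:E)%E.
Proof.
pose K := n.+1`!%:R * s ^+ n.+1.
have s_ge0 : 0 <= s by exact: ltW.
have K_ge0 : 0 <= K by rewrite mulr_ge0// exprn_ge0.
have mK : measurable_fun [set: T] (fun x => K * expR (s^-1 * W x)).
  exact: measurable_funM.
have -> : (n.+1`!%:R * (2 * expR (1 / 2)) * s ^+ n.+1)%:E =
    (\int[P]_x (K * expR (s^-1 * W x) + K * expR (- s^-1 * W x))%:E)%E.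
  rewrite ge0_integral_linear ?ge0_integral_scale//; last first.
    by move=> x; rewrite mulr_ge0.
  rewrite !integral_expR -!EFinM -EFinD sqrrN -exprMn divff ?gt_eqF//.
  by rewrite expr1n; congr (_%:E); rewrite /K; ring.
apply: ge0_le_integral => //.
  apply/measurable_EFinP; apply: measurable_funD => //; exact: measurable_funM.
move=> x _; rewrite lee_fin -mulrDr.
have -> : `|W x| ^+ n.+1 = s ^+ n.+1 * `|s^-1 * W x| ^+ n.+1.
  by rewrite -exprMn normrM gtr0_norm ?invr_gt0// mulrA divff ?mul1r// gt_eqF.
rewrite /K [_ * s ^+ _]mulrC -mulrA ler_wpM2l ?exprn_ge0// mulNr.
exact: normrX_le_expR.
Qed.

Lemma gaussian_mgf_integrable : P.-integrable [set: T] (EFin \o W).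
Proof.
apply/integrableP; split; first exact/measurable_EFinP.
apply: le_lt_trans (gaussian_mgf_abs_moment_le 0) _.
by rewrite ltry.
Qed.

Lemma gaussian_mgf_expectation : ('E_P[W] = 0)%E.
Proof.
have EW_fin : 'E_P[W]%E \is a fin_num.
  by rewrite unlock; exact: integrable_fin_num gaussian_mgf_integrable.
rewrite -(fineK EW_fin); congr (_%:E).
apply: (@affine_le_expR_sqr_eq0 _ (s ^+ 2)) => [|y].
  by rewrite exprn_gt0.
rewrite -lee_fin EFinD EFinM fineK// -integral_expR unlock.
have intW := gaussian_mgf_integrable.
have intyW : P.-integrable [set: T] (fun x => y%:E * (EFin \o W) x)%E.
  exact: integrableZl.
rewrite -integralZl// -(expectation_cst P 1) [in X in (X + _)%E]unlock.
rewrite -integralD//; last exact: finite_measure_integrable_cst.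
apply: le_integral => //.
- by apply: integrableD => //; exact: finite_measure_integrable_cst.
- apply/integrableP; split; first exact/measurable_EFinP.
  under eq_integral do rewrite gee0_abs ?lee_fin ?expR_ge0//.
  by rewrite integral_expR ltry.
- by move=> x _; rewrite /= -EFinM -EFinD lee_fin expR_ge1Dx.
Qed.

Lemma gaussian_mgf_second_moment_fin_num :
  (\int[P]_x (W x ^+ 2)%:E)%E \is a fin_num.
Proof.
rewrite ge0_fin_numE; last first.
  by apply: integral_ge0 => x _; rewrite lee_fin sqr_ge0.
under eq_integral do rewrite -real_normK ?num_real//.
by rewrite (le_lt_trans (gaussian_mgf_abs_moment_le 1)) ?ltry.
Qed.

Let expR_half_le_second_moment : ((expR (1 / 2))%:E <=
  1 + (expR 2 / s ^+ 2)%:E * \int[P]_x (W x ^+ 2)%:E + (1 / 4)%:E)%E.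
Proof.
pose b := expR 2 / s ^+ 2; pose c : R := (4 * expR 2)^-1.
have b_ge0 : 0 <= b by rewrite divr_ge0 ?sqr_ge0// ltW.
have c_ge0 : 0 <= c by rewrite invr_ge0 mulr_ge0// ltW.
have mW2 : measurable_fun [set: T] (fun x => W x ^+ 2).
  exact: measurable_funX.
have mbW2 : measurable_fun [set: T] (fun x => 1 + b * W x ^+ 2).
  by apply: measurable_funD => //; exact: measurable_funM.
have bW2_ge0 x : 0 <= 1 + b * W x ^+ 2 by rewrite addr_ge0// mulr_ge0// sqr_ge0.
have -> : (expR (1 / 2))%:E = (\int[P]_x (expR (s^-1 * W x))%:E)%E.
  by rewrite integral_expR; congr ((expR _)%:E); field; rewrite gt_eqF.
have -> : (1 + b%:E * \int[P]_x (W x ^+ 2)%:E + (1 / 4)%:E =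
    \int[P]_x (1 + b * W x ^+ 2 + c * expR (2 / s * W x))%:E)%E.
  rewrite !ge0_integral_linear//; last by move=> x; exact: sqr_ge0.
  rewrite integral_probability_cst integral_expR -EFinM; congr (_ + _%:E)%E.
  rewrite (_ : s ^+ 2 * _ / 2 = 2); last by field; rewrite gt_eqF.
  by rewrite /c; field; rewrite gt_eqF.
apply: ge0_le_integral => //.
- exact/measurable_EFinP.
- apply/measurable_EFinP; apply: measurable_funD => //.
  exact: measurable_funM.
move=> x _; rewrite lee_fin -addrA.
have /(expR_le_sqr (s^-1 * W x)) : 0 < 2 * expR 2 :> R by rewrite mulr_gt0.
congr (_ <= 1 + (_ + _)).
- by rewrite /b; field; rewrite gt_eqF.
- by congr (_^-1 * expR _); [ring|rewrite mulrA].
Qed.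

Lemma gaussian_mgf_second_moment_ge :
  (((s / (2 * expR 1)) ^+ 2)%:E <= \int[P]_x (W x ^+ 2)%:E)%E.
Proof.
have := expR_half_le_second_moment.
have /andP[half_ge _] := @expR_half_bounds R.
rewrite -(fineK gaussian_mgf_second_moment_fin_num) -EFinM -!EFinD !lee_fin.
have -> : (s / (2 * expR 1)) ^+ 2 = s ^+ 2 / (4 * expR 2).
  have -> : expR 2 = expR 1 ^+ 2 :> R by rewrite -expRM_natl mulr1.
  by field; rewrite gt_eqF ?expR_gt0.
set m2 := fine _ => le_m2.
have : 1 / 4 <= expR 2 / s ^+ 2 * m2 by lra.
by rewrite mulrAC ler_pdivlMr ?exprn_gt0// ler_pdivrMr ?mulr_gt0//; lra.
Qed.

Let truncation (n : nat) (v : R) x : R :=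
  Num.min 1 (`|W x| / (Num.sqrt n%:R * Num.sqrt v)).

Let truncation_ge0 n v x : 0 <= truncation n v x.
Proof. by rewrite le_min ler01/= divr_ge0// mulr_ge0// sqrtr_ge0. Qed.

Let measurable_truncation n v :
  measurable_fun [set: T] (fun x => (W x ^+ 2 / v * truncation n v x)%:E).
Proof.
apply/measurable_EFinP/measurable_funM.
  by apply: measurable_funM => //; exact: measurable_funX.
apply: measurable_minr => //; apply: measurable_funM => //.
exact: measurableT_comp.
Qed.

Lemma gaussian_mgf_truncated_moment_le n (v : R) : (0 < n)%N ->
  (\int[P]_x (W x ^+ 2)%:E = v%:E)%E ->
  (\int[P]_x (W x ^+ 2 / v *
     Num.min 1 (`|W x| / (Num.sqrt n%:R * Num.sqrt v)))%:E <=
   (truncation_bound n)%:E)%E.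
Proof.
move=> n_gt0 WvE; pose a := s / (2 * expR 1); pose D := a ^+ 3 * Num.sqrt n%:R.
have a_gt0 : 0 < a by rewrite divr_gt0// mulr_gt0.
have rn_gt0 : 0 < Num.sqrt n%:R :> R by rewrite sqrtr_gt0 ltr0n.
have a2_le : a ^+ 2 <= v by rewrite -lee_fin -WvE gaussian_mgf_second_moment_ge.
have v_gt0 : 0 < v by apply: lt_le_trans a2_le; rewrite exprn_gt0.
have a_le : a <= Num.sqrt v.
  by rewrite -(ger0_norm (ltW a_gt0)) -sqrtr_sqr ler_sqrt// ltW.
have D_ge0 : 0 <= D^-1 by rewrite invr_ge0 mulr_ge0 ?exprn_ge0 ?ltW.
have W2v_ge0 x : 0 <= W x ^+ 2 / v by rewrite divr_ge0 ?sqr_ge0// ltW.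
have truncation_le x : W x ^+ 2 / v * truncation n v x <= D^-1 * `|W x| ^+ 3.
  have -> : D^-1 * `|W x| ^+ 3 =
      W x ^+ 2 / a ^+ 2 * (`|W x| / (Num.sqrt n%:R * a)).
    by rewrite -[W x ^+ 2]real_normK ?num_real// /D; field; rewrite !gt_eqF.
  apply: ler_pM => //.
    by rewrite ler_wpM2l ?sqr_ge0// lef_pV2// posrE// exprn_gt0.
  rewrite ge_min; apply/orP; right; rewrite ler_wpM2l//.
  by rewrite lef_pV2 ?posrE ?mulr_gt0 ?sqrtr_gt0 ?ltr0n// ler_pM2l.
apply: (@le_trans _ _ (\int[P]_x (D^-1%:E * (`|W x| ^+ 3)%:E))%E).
  apply: ge0_le_integral => //.
  - by move=> x _; rewrite lee_fin (mulr_ge0 _ (truncation_ge0 n v x)).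
  - exact: measurable_truncation.
  - exact: emeasurable_funM.
  - by move=> x _; rewrite -EFinM lee_fin.
rewrite ge0_integralZl//.
have /(lee_wpmul2l _)/le_trans := gaussian_mgf_abs_moment_le 2; apply => //.
rewrite -EFinM lee_fin le_eqVlt; apply/orP; left; apply/eqP.
by rewrite /truncation_bound /D /a !factS fact0; field; rewrite !gt_eqF.
Qed.

End gaussian_mgf.

Section normal_tilt.
Context {R : realType}.
Implicit Types (s m c x : R).

Definition normal_tilt s m c x : R :=
  expR (c * (x - m) - s ^+ 2 * c ^+ 2 / 2).

Lemma measurable_normal_tilt s m c :
  measurable_fun [set: measurableTypeR R] (normal_tilt s m c).
Proof.
apply: measurableT_comp => //; apply: measurable_funB => //.
by apply: measurable_funM => //; exact: measurable_funB.
Qed.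

Lemma normal_pdf_tilt s m c x : s != 0 ->
  normal_pdf (m + s ^+ 2 * c) s x = normal_tilt s m c x * normal_pdf m s x.
Proof.
move=> s_neq0; rewrite !normal_pdfE// mulrCA -expRD.
by congr (_ * expR _); field.
Qed.

Lemma ge0_integral_normal_prob s m (f : measurableTypeR R -> \bar R) :
  measurable_fun [set: measurableTypeR R] f -> (forall x, 0 <= f x)%E ->
  (\int[normal_prob m s]_x f x =
   \int[lebesgue_measure]_x (f x * (normal_pdf m s x)%:E))%E.
Proof.
apply: ge0_integral_density => //; first exact: measurable_normal_pdf.
exact: normal_pdf_ge0.
Qed.

Lemma likelihood_ratio_normal_prob s m c : s != 0 ->
  likelihood_ratio (normal_prob m s : probability (measurableTypeR R) R)
    (normal_prob (m + s ^+ 2 * c) s) (normal_tilt s m c).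
Proof.
move=> s_neq0; split=> [|x|f mf f_ge0]; first exact: measurable_normal_tilt.
- exact: expR_ge0.
have mt := measurable_normal_tilt s m c.
rewrite [LHS]ge0_integral_normal_prob// [RHS]ge0_integral_normal_prob.
- by apply: eq_integral => x _; rewrite normal_pdf_tilt// EFinM muleA.
- by apply: emeasurable_funM => //; exact/measurable_EFinP.
- by move=> x; rewrite mule_ge0 ?lee_fin ?expR_ge0.
Qed.

End normal_tilt.

Section gaussian_law.
Context {R : realType} {d : nat}.
Implicit Types (s : R) (m b c : 'I_d -> R).

Definition gaussian_law m s : probability (rvec R d) R :=
  product_law (fun k => normal_prob (m k) s).

Definition gaussian_tilt s m c (x : rvec R d) : R :=
  \prod_k normal_tilt s (m k) (c k) (coordinate k x).

Lemma gaussian_tiltE s m c x : gaussian_tilt s m c x =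
  expR (\sum_k c k * (coordinate k x - m k)) *
  expR (- (s ^+ 2 * (\sum_k c k ^+ 2) / 2)).
Proof.
rewrite -expRD mulr_sumr mulr_suml -sumrN -big_split /gaussian_tilt.
by rewrite -expR_sum.
Qed.

Lemma likelihood_ratio_gaussian_law s m c : s != 0 ->
  likelihood_ratio (gaussian_law m s)
    (gaussian_law (fun k => m k + s ^+ 2 * c k) s) (gaussian_tilt s m c).
Proof.
move=> s_neq0; exact: (likelihood_ratio_product_law
  (fun k => likelihood_ratio_normal_prob (m k) (c k) s_neq0)).
Qed.

Lemma measurable_coordinate (k : 'I_d) :
  measurable_fun [set: rvec R d] (@coordinate R d k).
Proof. exact: measurable_tnth. Qed.

Lemma measurable_linear_form m c : measurable_fun [set: rvec R d]
  (fun x => \sum_k c k * (coordinate k x - m k)).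
Proof.
apply: measurable_sum => k; apply: measurable_funM => //.
by apply: measurable_funB => //; exact: measurable_coordinate.
Qed.

Lemma gaussian_law_mgf s m c : s != 0 ->
  (\int[gaussian_law m s]_x
     (expR (\sum_k c k * (coordinate k x - m k)))%:E =
   (expR (s ^+ 2 * (\sum_k c k ^+ 2) / 2))%:E)%E.
Proof.
move=> s_neq0; set q := s ^+ 2 * _ / 2.
have /likelihood_ratio_total := likelihood_ratio_gaussian_law m c s_neq0.
under eq_integral do rewrite gaussian_tiltE -/q EFinM.
rewrite ge0_integralZr ?lee_fin ?expR_ge0//.
- move/(congr1 (mule^~ (expR q)%:E)); rewrite mul1e -muleA -EFinM.
  by rewrite [_ * expR q]mulrC expRxMexpNx_1 mule1.
- apply/measurable_EFinP/measurableT_comp => //; exact: measurable_linear_form.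
Qed.

Lemma gaussian_tilt_overlap s m b c : s != 0 ->
  (\int[gaussian_law m s]_x
     (gaussian_tilt s m b x * gaussian_tilt s m c x)%:E =
   (expR (s ^+ 2 * \sum_k b k * c k))%:E)%E.
Proof.
move=> s_neq0.
pose q (v : 'I_d -> R) := s ^+ 2 * (\sum_k v k ^+ 2) / 2.
have tiltM x : gaussian_tilt s m b x * gaussian_tilt s m c x =
    expR (- q b - q c) *
    expR (\sum_k (b k + c k) * (coordinate k x - m k)).
  rewrite !gaussian_tiltE -!expRD; congr expR.
  by under [in RHS]eq_bigr do rewrite mulrDl; rewrite big_split/= /q; ring.
under eq_integral do rewrite tiltM EFinM.
rewrite ge0_integralZl ?lee_fin ?expR_ge0//; last first.
  apply/measurable_EFinP/measurableT_comp => //; exact: measurable_linear_form.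
rewrite gaussian_law_mgf// -EFinM -expRD; congr ((expR _)%:E).
have -> : \sum_k (b k + c k) ^+ 2 =
    \sum_k b k ^+ 2 + \sum_k c k ^+ 2 + 2 * \sum_k b k * c k.
  by rewrite mulr_sumr -!big_split; apply: eq_bigr => k _ /=; ring.
by rewrite /q; field.
Qed.

End gaussian_law.

Section gaussian_population.
Context {R : realType} {d : nat} (m : 'I_d -> R) (s : R).
Hypothesis s_gt0 : 0 < s.

Local Notation P := (gaussian_law m s).

Let s_neq0 : s != 0. Proof. by rewrite gt_eqF. Qed.

Lemma gaussian_law_linear_mgf (c : 'I_d -> R) :
  gaussian_mgf P (s * Num.sqrt (\sum_k c k ^+ 2))
    (fun x => \sum_k c k * (coordinate k x - m k)).
Proof.
split=> [|y]; first exact: measurable_linear_form.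
rewrite /mmt_gen_fun unlock.
have c2_ge0 : 0 <= \sum_k c k ^+ 2 by apply: sumr_ge0 => k _; exact: sqr_ge0.
transitivity (\int[P]_x
    (expR (\sum_k y * c k * (coordinate k x - m k)))%:E)%E.
  apply: eq_integral => x _ /=; rewrite mulrC mulr_sumr.
  by congr ((expR _)%:E); apply: eq_bigr => k _; rewrite mulrA.
rewrite gaussian_law_mgf// exprMn sqr_sqrtr//; congr ((expR (_ / 2))%:E).
by under eq_bigr do rewrite exprMn; rewrite -mulr_sumr; ring.
Qed.

Lemma gaussian_law_coordinate_mgf k :
  gaussian_mgf P s (fun x => coordinate k x - m k).
Proof.
have := gaussian_law_linear_mgf (fun i => (i == k)%:R).
rewrite (eq_bigr (fun i => (i == k)%:R * (i == k)%:R)); last first.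
  by move=> i _; rewrite expr2.
rewrite (sumr_delta k (fun i => (i == k)%:R)) eqxx sqrtr1 mulr1.
by under [X in gaussian_mgf _ _ X]eq_fun do rewrite sumr_delta.
Qed.

Lemma centered_coordinate_Lfun k :
  (fun x : rvec R d => coordinate k x - m k) \in Lfun P 1.
Proof.
apply/Lfun1_integrable/(gaussian_mgf_integrable s_gt0).
exact: gaussian_law_coordinate_mgf.
Qed.

Lemma gaussian_law_has_mean : has_mean P.
Proof.
move=> k; apply/Lfun1_integrable.
rewrite (_ : coordinate k = (fun x => coordinate k x - m k) \+ cst (m k)).
  by rewrite rpredD ?Lfun_cst// centered_coordinate_Lfun.
by apply/funext => x /=; rewrite subrK.
Qed.

Lemma gaussian_law_mean k : mean P k = m k.
Proof.
rewrite /mean.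
rewrite (_ : coordinate k = (fun x => coordinate k x - m k) \+ cst (m k)).
  rewrite expectationD ?Lfun_cst ?centered_coordinate_Lfun// expectation_cst.
  rewrite (gaussian_mgf_expectation s_gt0 (gaussian_law_coordinate_mgf k)).
  by rewrite add0e.
by apply/funext => x /=; rewrite subrK.
Qed.

Lemma gaussian_law_contrastE r k x :
  contrast P r k x = (coordinate r x - m r) - (coordinate k x - m k).
Proof. by rewrite /contrast !gaussian_law_mean. Qed.

Lemma gaussian_law_contrast_mgf r k : k != r ->
  gaussian_mgf P (s * Num.sqrt 2) (contrast P r k).
Proof.
move=> kr; pose c i : R := (i == r)%:R - (i == k)%:R.
have := gaussian_law_linear_mgf c.
rewrite (eq_bigr (fun i => (i == r)%:R * c i - (i == k)%:R * c i)); last first.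
  by move=> i _; rewrite /c; ring.
have rk : (r == k) = false by rewrite eq_sym (negbTE kr).
rewrite sumrB !sumr_delta /c !eqxx (negbTE kr) rk.
rewrite (_ : _ - _ = 2) /=; last by ring.
congr (gaussian_mgf _ _ _); apply/funext => x; rewrite gaussian_law_contrastE.
under eq_bigr do rewrite mulrBl.
by rewrite sumrB !sumr_delta.
Qed.

Lemma gaussian_law_sub_gaussian : sub_gaussian s P.
Proof.
split=> [|v l v1]; first exact: gaussian_law_has_mean.
have [_ /(_ l)] := gaussian_law_linear_mgf v.
rewrite v1 sqrtr1 mulr1 /mmt_gen_fun => /eqP; rewrite eq_le => /andP[+ _].
rewrite [l ^+ 2 * _]mulrC; congr (_ <= _)%E; congr expectation.
apply/funext => x /=; rewrite mulrC; congr (expR (_ * _)).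
by apply: eq_bigr => k _; rewrite gaussian_law_mean.
Qed.

Let contrast_sd_gt0 : 0 < s * Num.sqrt 2.
Proof. by rewrite mulr_gt0// sqrtr_gt0. Qed.

Lemma gaussian_law_contrast_var_fin_num r k : k != r ->
  contrast_var P r k \is a fin_num.
Proof.
move=> kr; rewrite /contrast_var unlock.
exact: gaussian_mgf_second_moment_fin_num contrast_sd_gt0
  (gaussian_law_contrast_mgf kr).
Qed.

Lemma gaussian_law_contrast_var_gt0 r k : k != r -> (0 < contrast_var P r k)%E.
Proof.
move=> kr; rewrite /contrast_var unlock.
have := gaussian_mgf_second_moment_ge contrast_sd_gt0
  (gaussian_law_contrast_mgf kr).
apply: lt_le_trans; rewrite lte_fin exprn_gt0// divr_gt0// mulr_gt0.
Qed.

Lemma gaussian_law_null_distribution r :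
  (forall k, m r <= m k) -> null_distribution r P.
Proof.
move=> m_r_min; split; first exact: gaussian_law_has_mean.
- move=> k kr; rewrite gaussian_law_contrast_var_gt0//= ltey_eq.
  by rewrite gaussian_law_contrast_var_fin_num.
- by apply/forallP => k; rewrite !gaussian_law_mean.
Qed.

Lemma gaussian_law_truncated_moment_le n r k : (0 < n)%N -> k != r ->
  (truncated_moment n P r k <= (truncation_bound n)%:E)%E.
Proof.
move=> n_gt0 kr; rewrite /truncated_moment unlock.
apply: (gaussian_mgf_truncated_moment_le contrast_sd_gt0) => //.
  exact: gaussian_law_contrast_mgf.
rewrite fineK ?gaussian_law_contrast_var_fin_num//.
by rewrite /contrast_var unlock.
Qed.

End gaussian_population.

(** * Tests *)

Section minimax.
Context {R : realType} (d : nat -> nat) (r : forall n, 'I_(d n)).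
Implicit Types (psi : test_sequence (R := R) d).

Lemma measurable_rejection psi n : measurable [set x | psi n x = true].
Proof. exact: (measurable_funPTI (psi n) (Y := [set true])). Qed.

Lemma type1_error_fin_num psi n (P : probability (rvec R (d n)) R) :
  type1_error psi P \is a fin_num.
Proof. by apply: fin_num_measure; exact: measurable_rejection. Qed.

Lemma type2_errorE psi n (P : probability (rvec R (d n)) R) :
  type2_error psi P = (1 - type1_error psi P)%E.
Proof.
rewrite /type2_error /type1_error -probability_setC.
  by congr (iid_law _ _ _); apply/seteqP; split=> x /=; case: (psi n x).
exact: measurable_rejection.
Qed.

Lemma asymptotic_level_type2_ge (alpha delta : R) psi
    (P0 : forall n, probability (rvec R (d n)) R)
    (P1 : forall n, set (probability (rvec R (d n)) R)) :
  asymptotic_level r alpha psi -> null_collection r (fun n => [set P0 n]) ->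
  (\forall n \near \oo, exists2 Q, P1 n Q &
    (type1_error psi Q <= type1_error psi (P0 n) + delta%:E)%E) ->
  ((1 - alpha - delta)%:E <=
   limn_einf (fun n => ereal_sup [set type2_error psi P | P in P1 n]))%E.
Proof.
move=> level null close.
pose T1 n := type1_error psi (P0 n).
have T1_level : (limn_esup T1 <= alpha%:E)%E.
  under [T1]eq_fun do rewrite -[type1_error _ _]ereal_sup1 -image_set1.
  exact: level null.
apply: (@le_trans _ _ ((1 - delta)%:E + limn_einf (-%E \o T1))%E).
  rewrite limn_einfN (_ : 1 - alpha - delta = 1 - delta - alpha); last by ring.
  by rewrite EFinB leeD2l// leeN2.
rewrite -limn_einf_shift//; apply: le_limn_einf.
near=> n.
have [Q PQ QP] : exists2 Q, P1 n Q & (type1_error psi Q <=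
  type1_error psi (P0 n) + delta%:E)%E by near: n; exact: close.
apply: le_ereal_sup_tmp; exists (type2_error psi Q); first by exists Q.
move: QP; rewrite type2_errorE /comp /T1.
rewrite -(fineK (type1_error_fin_num psi Q))
  -(fineK (type1_error_fin_num psi (P0 n))) -EFinD -!EFinB !lee_fin; lra.
Unshelve. all: by end_near. Qed.

Lemma gaussian_null_collection (m : forall n, 'I_(d n) -> R) (s : R) :
  0 < s -> (forall n k, m n (r n) <= m n k) ->
  null_collection r (fun n => [set gaussian_law (m n) s]).
Proof.
move=> s_gt0 m_min; split=> [n _ ->|].
  exact: gaussian_law_null_distribution.
apply: (@squeeze_cvge _ _ _ _ (cst 0%E) _ (EFin \o truncation_bound)).
- near=> n; apply/andP; split; first exact: bigmax_ge_id.
  have n_gt0 : (0 < n)%N by near: n; exact: nbhs_infty_gt.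
  apply/bigmax_leP; split=> [|k kr].
    by rewrite lee_fin divr_ge0// sqrtr_ge0.
  by rewrite image_set1 ereal_sup1 gaussian_law_truncated_moment_le.
- exact: cvg_cst.
- exact: cvg_div_sqrtn.
Unshelve. all: by end_near. Qed.

End minimax.

(** * The least favorable alternatives *)

Definition confusion_width {R : realType} (C : R) (d n : nat) : R :=
  C * Num.sqrt (ln d%:R / n%:R).

Section needle.
Context {R : realType} {d : nat} (r : 'I_d) (S : {set 'I_d}) (sigma eps M : R).
Hypotheses (sigma_gt0 : 0 < sigma) (eps_gt0 : 0 < eps) (M_gt0 : 0 < M).
Hypothesis rS : r \notin S.

(* Coordinate [r] and those of [S] tie for the minimum. Once coordinate [j] of
   [S] is lowered by [eps], the rest of [S] is the confusion set, as the other
   coordinates lie above the confusion window. *)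
Definition base_mean (k : 'I_d) : R := if (k == r) || (k \in S) then 0 else M.

Definition needle_mean (j k : 'I_d) : R := base_mean k - (k == j)%:R * eps.

Definition needle_direction (j k : 'I_d) : R :=
  - (k == j)%:R * (eps / sigma ^+ 2).

Lemma base_mean_r : base_mean r = 0.
Proof. by rewrite /base_mean eqxx. Qed.

Lemma base_mean_in k : k \in S -> base_mean k = 0.
Proof. by rewrite /base_mean => ->; rewrite orbT. Qed.

Lemma base_mean_ge0 k : 0 <= base_mean k.
Proof. by rewrite /base_mean; case: ifP => // _; exact: ltW. Qed.

Lemma base_mean_r_le k : base_mean r <= base_mean k.
Proof. by rewrite base_mean_r base_mean_ge0. Qed.

Lemma likelihood_ratio_needle j :
  likelihood_ratio (gaussian_law base_mean sigma)
    (gaussian_law (needle_mean j) sigma)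
    (gaussian_tilt sigma base_mean (needle_direction j)).
Proof.
have -> : needle_mean j =
    fun k => base_mean k + sigma ^+ 2 * needle_direction j k.
  apply/funext => k; rewrite /needle_mean /needle_direction.
  by move: (k == j)%:R => e; field; rewrite gt_eqF.
exact/likelihood_ratio_gaussian_law/lt0r_neq0.
Qed.

Lemma needle_overlap i j :
  (\int[gaussian_law base_mean sigma]_x
     (gaussian_tilt sigma base_mean (needle_direction i) x *
      gaussian_tilt sigma base_mean (needle_direction j) x)%:E =
   (if i == j then expR (eps ^+ 2 / sigma ^+ 2) else 1)%:E)%E.
Proof.
rewrite gaussian_tilt_overlap ?lt0r_neq0//.
have -> : \sum_k needle_direction i k * needle_direction j k =
    (i == j)%:R * (eps / sigma ^+ 2) ^+ 2.
  rewrite -(sumr_delta i (fun k => (k == j)%:R * (eps / sigma ^+ 2) ^+ 2)).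
  by apply: eq_bigr => k _; rewrite /needle_direction; ring.
case: eqP => _; last by rewrite mul0r mulr0 expR0.
by rewrite mul1r; congr ((expR _)%:E); field; rewrite gt_eqF.
Qed.

Section alternative.
Variables (j : 'I_d) (jS : j \in S).

Local Notation P := (gaussian_law (needle_mean j) sigma).

Let jr : j != r. Proof. by apply: contraNneq rS => <-. Qed.

Lemma mean_needle_at : mean P j = - eps.
Proof.
by rewrite gaussian_law_mean// /needle_mean base_mean_in// eqxx mul1r sub0r.
Qed.

Lemma mean_needle_off k : k != j -> mean P k = base_mean k.
Proof.
move=> /negbTE kj.
by rewrite gaussian_law_mean// /needle_mean kj mul0r subr0.
Qed.

Lemma mean_needle_ge k : - eps <= mean P k.
Proof.
have [->|/mean_needle_off ->] := eqVneq k j; first by rewrite mean_needle_at.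
by rewrite (le_trans _ (base_mean_ge0 k))// oppr_le0 ltW.
Qed.

Lemma mean_needle_r : mean P r = 0.
Proof. by rewrite mean_needle_off ?base_mean_r// eq_sym. Qed.

Lemma min_mean_needle : min_mean P r = - eps.
Proof.
apply/eqP; rewrite eq_le; apply/andP; split; last first.
  by apply/bigmin_geP; split=> [|k _]; exact: mean_needle_ge.
by rewrite /min_mean (bigminD1 j)//= ge_min mean_needle_at lexx.
Qed.

Lemma best_but_needle k : best_but P r k = (k == j).
Proof.
rewrite /best_but/=; apply/andP/eqP => [[kr /forall_inP/(_ j jr)]|->].
  apply: contraTeq => kj; rewrite mean_needle_at mean_needle_off// -ltNge.
  by rewrite (lt_le_trans _ (base_mean_ge0 k))// oppr_lt0.
split; first exact: jr.
by apply/forall_inP => i _; rewrite mean_needle_at mean_needle_ge.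
Qed.

Lemma confusion_set_needle (C : R) n :
  eps <= confusion_width C d n < M ->
  confusion_set C n P r =i (S :\ j)%SET.
Proof.
rewrite /confusion_width => /andP[epsC CM] k.
rewrite !inE best_but_needle mean_needle_r min_mean_needle sub0r opprK.
have [->|kj] := eqVneq k j; first by rewrite andbF.
rewrite mean_needle_off// /base_mean.
have [->|kr] := eqVneq k r; first by rewrite (negbTE rS).
have [kS|kS] := boolP (k \in S) => /=.
  by rewrite add0r epsC andbT; apply/idP; have := eps_gt0; lra.
apply/negbTE; rewrite negb_and -!ltNge; apply/orP; right.
by have := eps_gt0; lra.
Qed.

Lemma alternative_class_needle (C : R) n tau : #|S| = tau.+1 ->
  eps <= confusion_width C d n < M ->
  alternative_class sigma C n r eps tau P.
Proof.
move=> cardS epsCM; split; first exact: gaussian_law_sub_gaussian.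
- by rewrite mean_needle_r min_mean_needle sub0r opprK.
- rewrite (eq_card (confusion_set_needle epsCM)).
  by have := cardsD1 j S; rewrite jS cardS => -[].
Qed.

End alternative.

Lemma exists_close_needle (C delta : R) n tau A :
  #|S| = tau.+1 -> 0 < delta ->
  expR (eps ^+ 2 / sigma ^+ 2) ^+ (2 * n) - 1 <= delta ^+ 2 * tau.+1%:R ->
  eps <= confusion_width C d n < M ->
  measurable A ->
  exists2 Q, alternative_class sigma C n r eps tau Q &
    (iid_law Q (2 * n) A <=
     iid_law (gaussian_law base_mean sigma) (2 * n) A + delta%:E)%E.
Proof.
move=> cardS delta_gt0 chi2 epsCM mA.
have cardI : #|{: {j | j \in S}}| = tau.+1 by rewrite card_sig -cardS.
have [|||[j jS] QP] := @exists_iid_alternative_le _ _ R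
    (gaussian_law base_mean sigma) {j | j \in S} _ _
    (expR (eps ^+ 2 / sigma ^+ 2)) delta _ _ mA delta_gt0 _
    (fun j => likelihood_ratio_needle (val j)).
- by rewrite cardI.
- by move=> i j; rewrite needle_overlap.
- by rewrite cardI.
exists (gaussian_law (needle_mean j) sigma) => //.
exact: alternative_class_needle.
Qed.

End needle.

Section needle_set.
Context {d : nat} (r : 'I_d).

Definition needle_set k : {set 'I_d} := [set i in take k (enum [set~ r])]%SET.

Lemma notin_needle_set k : r \notin needle_set k.
Proof.
by rewrite inE; apply/negP => /mem_take; rewrite mem_enum !inE eqxx.
Qed.

Lemma card_needle_set k : (k < d)%N -> #|needle_set k| = k.
Proof.
move=> k_lt; rewrite cardsE (card_uniqP _) ?take_uniq ?enum_uniq//.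
rewrite size_takel// -cardE cardsC1 card_ord.
by rewrite -ltnS (leq_trans k_lt)// leqSpred.
Qed.

End needle_set.

Section critical_radius.
Context {R : realType}.

Lemma expR_max1_ln_le tau : expR (Num.max 1 (ln tau%:R)) <= 4 + tau%:R :> R.
Proof.
rewrite /Num.max; case: ifPn => [ln_gt1|_].
  have tau_gt0 : (0 < tau)%N.
    by rewrite lt0n; apply: contraTneq ln_gt1 => ->; rewrite ln0// -leNgt.
  by rewrite lnK ?posrE ?ltr0n//; lra.
by have := @expR1_le4 R; have := ler0n R tau; lra.
Qed.

Lemma chi2_critical_radius_le (sigma delta eps : R) n tau :
  0 < sigma -> 0 < delta -> delta <= 1 -> 0 < eps -> (0 < n)%N ->
  eps <= delta * sigma / 3 * critical_radius n tau ->
  expR (eps ^+ 2 / sigma ^+ 2) ^+ (2 * n) - 1 <= delta ^+ 2 * tau.+1%:R.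
Proof.
move=> sigma_gt0 delta_gt0 delta_le1 eps_gt0 n_gt0.
rewrite /critical_radius; set L := Num.max _ _ => eps_le.
have n_gt0R : 0 < n%:R :> R by rewrite ltr0n.
have L_ge1 : 1 <= L by rewrite le_max lexx.
pose b := 2 / 9 * delta ^+ 2.
have b_01 : 0 <= b <= 1.
  have : delta ^+ 2 <= 1 by rewrite expr_le1// ltW.
  by have := sqr_ge0 delta; rewrite /b; lra.
have eps2_le : eps ^+ 2 <= (delta * sigma / 3) ^+ 2 * (L / n%:R).
  have Ln_ge0 : 0 <= L / n%:R by apply: divr_ge0; lra.
  rewrite -[L / _]sqr_sqrtr// -exprMn lerXn2r// nnegrE ltW//.
  exact: lt_le_trans eps_le.
have expo_le : (2 * n)%:R * (eps ^+ 2 / sigma ^+ 2) <= b * L.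
  have -> : b * L = (2 * n)%:R * ((delta * sigma / 3) ^+ 2 * (L / n%:R) /
      sigma ^+ 2) by rewrite natrM /b; field; rewrite !gt_eqF.
  by rewrite ler_wpM2l// ler_wpM2r// invr_ge0 sqr_ge0.
apply: (@le_trans _ _ (b * (expR L - 1))).
  apply: le_trans (expR_scale_sub1_le _ b_01).
  by rewrite lerD2r -expRM_natl ler_expR.
apply: (@le_trans _ _ (b * (3 + tau%:R))).
  have := expR_max1_ln_le tau; rewrite -/L => L_le.
  by apply: ler_wpM2l; [case/andP: b_01|lra].
have := mulr_ge0 (sqr_ge0 delta) (ler0n R tau).
by have := sqr_ge0 delta; rewrite -natr1 /b; lra.
Qed.

Lemma critical_radius_le_width n tau d : (2 <= d)%N -> (tau <= d)%N ->
  critical_radius n tau <= confusion_width 2 d n :> R.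
Proof.
move=> d_ge2 tau_le; rewrite /critical_radius /confusion_width.
have ln2_ge : 1 / 4 <= ln 2 :> R.
  rewrite -ler_expR lnK ?posrE//; have /andP[_] := @expR_half_bounds R.
  by apply: le_trans; rewrite ler_expR; lra.
have ln_d_ge : ln 2 <= ln d%:R :> R.
  by rewrite ler_ln ?posrE ?ltr0n ?ler_nat// (leq_trans _ d_ge2).
have ln_tau_le : ln tau%:R <= ln d%:R :> R.
  have [->|tau_gt0] := posnP tau; first by rewrite ln0//; lra.
  by rewrite ler_ln ?posrE ?ltr0n ?ler_nat// (leq_trans _ d_ge2).
have sqrt4 : Num.sqrt (2 ^+ 2) = 2 :> R by rewrite sqrtr_sqr ger0_norm.
rewrite -[X in _ <= X * _]sqrt4 -sqrtrM ?sqr_ge0// ler_wsqrtr// mulrA.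
by rewrite ler_wpM2r ?invr_ge0// ge_max; lra.
Qed.

Lemma scaled_critical_radius_le_width (b C : R) n tau d :
  0 <= b -> 2 * b <= C -> (2 <= d)%N -> (tau <= d)%N ->
  b * critical_radius n tau <= confusion_width C d n.
Proof.
move=> b_ge0 bC d_ge2 tau_le.
apply: le_trans (ler_wpM2l b_ge0 (critical_radius_le_width n d_ge2 tau_le)) _.
by rewrite /confusion_width mulrA [b * 2]mulrC ler_wpM2r ?sqrtr_ge0.
Qed.

End critical_radius.

Theorem theorem3p3 (R : realType) (alpha beta sigma : R)
    (halpha : 0 < alpha < 1 / 2) (hbeta : 0 < beta < 1 - 2 * alpha)
    (hsigma : 0 < sigma) :
  exists2 c : R, 0 < c &
  forall (d : nat -> nat) (r : forall n, 'I_(d n)) (C : nat -> R)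
    (tau : nat -> nat) (eps : nat -> R),
  (forall n, (2 <= d n)%N) ->
  (forall n, 0 < C n) -> C n @[n --> \oo] --> +oo ->
  (forall n, (tau n <= d n - 2)%N) ->
  (forall n, 0 < eps n) ->
  (forall n, (0 < n)%N -> eps n <= c * critical_radius n (tau n)) ->
  (beta%:E <=
   ereal_inf
     [set limn_einf (fun n =>
        ereal_sup [set type2_error psi P |
          P in alternative_class sigma (C n) n (r n) (eps n) (tau n)])
     | psi in asymptotic_level r alpha])%E.
Proof.
pose delta := 1 - alpha - beta.
have [delta_gt0 delta_le1] : 0 < delta /\ delta <= 1.
  by rewrite /delta; split; lra.
pose c := delta * sigma / 3; have c_gt0 : 0 < c by rewrite divr_gt0// mulr_gt0.
exists c => // d r C tau eps d_ge2 C_gt0 C_cvg tau_le eps_gt0 eps_le.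
apply: le_ereal_inf_tmp => _ [psi psi_level <-].
have -> : beta = 1 - alpha - delta by rewrite /delta; ring.
pose S n := needle_set (r n) (tau n).+1.
pose M n := confusion_width (C n) (d n) n + 1.
have M_gt0 n : 0 < M n by rewrite ltr_wpDl// mulr_ge0 ?sqrtr_ge0// ltW.
apply: asymptotic_level_type2_ge psi_level (gaussian_null_collection hsigma
  (fun n => base_mean_r_le (r n) (S n) (M_gt0 n))) _.
near=> n; have n_gt0 : (0 < n)%N by near: n; exact: nbhs_infty_gt.
have eps_le_n := eps_le n n_gt0.
apply: exists_close_needle => //.
- exact: notin_needle_set.
- by rewrite card_needle_set// -(subnK (d_ge2 n)) addn2 !ltnS tau_le.
- exact: chi2_critical_radius_le.
- rewrite ltrDl ltr01 andbT; apply: (le_trans eps_le_n).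
  apply: scaled_critical_radius_le_width => //.
  + exact: ltW.
  + by near: n; move/cvgryPge : C_cvg; exact.
  + exact: leq_trans (tau_le n) (leq_subr _ _).
- exact: measurable_rejection.
Unshelve. all: by end_near. Qed.
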